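(* Let $f:\mathbb{R}^n\to\mathbb{R}$ be differentiable, $\mu$-strongly convex and $L$-smooth with minimizer $x^\star$. Let $(x_k,v_k,\gamma_k)_{k\ge0}$ be generated by the fully implicit scheme described in the context with stepsizes satisfying $\alpha_k\ge1$ and $\underline\alpha\le\alpha_k\le\overline\alpha$ for all $k$, where $0<\underline\alpha\le\overline\alpha<\infty$, and with $\gamma_{k+1}=\frac{\gamma_k+\alpha_k\mu}{1+\alpha_k}$, $\gamma_0>0$. There exist constants $G>0$, $C>0$ and a choice $\theta=\Theta(1/\underline\alpha)$, depending only on $(\mu,L,\underline\alpha,\overline\alpha,\gamma_0)$, such that $$V_k:=\mathbb{E}\|x_k-x^\star\|^2+\theta\,\mathbb{E}\|x_{k-1}-x^\star\|^2$$ satisfies, for all $k\ge1$, $$V_{k+1}\le\frac{G}{\underline\alpha}V_k+\frac{C\sigma^2}{\alpha_k}.$$ Consequently, with $\rho:=G/\underline\alpha$, for all $k\ge1$, $$V_k\le\rho^{k-1}V_1+\sum_{t=1}^{k-1}\rho^{k-1-t}\frac{C\sigma^2}{\alpha_t}.$$ In particular, if $\underline\alpha>G$, then $$\limsup_{k\to\infty}\mathbb{E}\|x_k-x^\star\|^2\le\limsup_{k\to\infty}V_k\le\frac{C\sigma^2}{\underline\alpha(1-G/\underline\alpha)}.$$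
   Context: Norms are Euclidean. Assumption on $f$: there are $0<\mu\le L<\infty$ such that for all $x,y\in\mathbb{R}^n$, $\frac{\mu}{2}\|x-y\|^2\le f(x)-f(y)-\langle\nabla f(y),x-y\rangle\le\frac{L}{2}\|x-y\|^2$; $x^\star=\arg\min f$. For $\lambda>0$, $\mathrm{prox}_{\lambda f}(z)=\arg\min_x\{\lambda f(x)+\frac12\|x-z\|^2\}$. Scheme: given $x_0,v_0\in\mathbb{R}^n$, $\gamma_0>0$ and deterministic stepsizes $(\alpha_k)$, for $k\ge0$ set $$\tau_k=\frac1{\alpha_k}+\frac{\mu}{\gamma_k},\quad c_k=\frac{v_k+\tau_kx_k}{1+\tau_k},\quad\lambda_k=\frac{\alpha_k}{\gamma_k(1+\tau_k)},\quad\xi_k=\frac{\sqrt{\alpha_k}}{1+\tau_k}\Sigma^{1/2}\eta_k,$$ $$x_{k+1}=\mathrm{prox}_{\lambda_kf}(c_k+\xi_k),\quad v_{k+1}=x_{k+1}+\frac{x_{k+1}-x_k}{\alpha_k},\quad\gamma_{k+1}=\frac{\gamma_k+\alpha_k\mu}{1+\alpha_k}.$$ Noise: $\eta_k\sim\mathcal N(0,I_n)$ independent (normalized Brownian increments), $\Sigma\succeq0$ fixed, and $\sigma^2=\mathrm{tr}(\Sigma)$ (or any upper bound on $\mathbb{E}\|\Sigma^{1/2}\eta_k\|^2$). $\theta=\Theta(1/\underline\alpha)$ means $\theta$ is a positive constant multiple of order $1/\underline\alpha$. *)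

(* Defs.v *)
From HB Require Import structures.
From mathcomp Require Import all_boot all_order all_algebra.
From mathcomp Require Import all_classical all_reals all_analysis.
Set Implicit Arguments.
Unset Strict Implicit.
Unset Printing Implicit Defensive.
Import Order.TTheory GRing.Theory Num.Theory.
Import numFieldNormedType.Exports.
Local Open Scope classical_set_scope.
Local Open Scope ring_scope.

Definition dotp (R : realType) n (u v : 'cV[R]_n) : R :=
  \sum_(i < n) u i 0 * v i 0.

(* Euclidean norm; the library's norm `|u| on matrices is the sup norm (both
   induce the same topology, hence the same notion of differentiability). *)
Definition enorm (R : realType) n (u : 'cV[R]_n) : R := Num.sqrt (dotp u u).

Definition grad (R : realType) n (f : 'cV[R]_n -> R) (y : 'cV[R]_n) : 'cV[R]_n :=
  \col_(i < n) 'D_(delta_mx i 0) f y.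

Definition strongly_convex_smooth (R : realType) n (mu L : R)
    (f : 'cV[R]_n -> R) : Prop :=
  forall x y : 'cV[R]_n,
    mu / 2 * enorm (x - y) ^+ 2
      <= f x - f y - dotp (grad f y) (x - y)
      <= L / 2 * enorm (x - y) ^+ 2.

Definition is_argmin (R : realType) n (g : 'cV[R]_n -> R) (p : 'cV[R]_n) : Prop :=
  forall x, g p <= g x.

(* For strongly convex f and lam > 0 there is exactly one such p. *)
Definition is_prox (R : realType) n (lam : R) (f : 'cV[R]_n -> R)
    (z p : 'cV[R]_n) : Prop :=
  is_argmin (fun x => lam * f x + 2^-1 * enorm (x - z) ^+ 2) p.

Definition psd (R : realType) n (S : 'M[R]_n) : Prop :=
  S^T = S /\ forall u : 'cV[R]_n, 0 <= dotp u (S *m u).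

Definition is_psd_sqrt (R : realType) n (S Sh : 'M[R]_n) : Prop :=
  psd Sh /\ Sh *m Sh = S.

(* Random vectors of R^n are n.-tuple R valued: the library equips that type with
   the sigma-algebra generated by the coordinates. *)
Definition col_of_tuple (R : realType) n (t : n.-tuple R) : 'cV[R]_n :=
  \col_(i < n) tnth t i.

(* X ~ N(0, I_n), that is, the law of X is the n-fold product of N(0, 1). *)
Definition std_gaussian (d : measure_display) (T : measurableType d)
    (R : realType) (P : probability T R) n (X : {RV P >-> n.-tuple R}) : Prop :=
  forall B : 'I_n -> set R, (forall i, measurable (B i)) ->
    P [set w | forall i, B i (tnth (X w) i)]
      = (\prod_(i < n) normal_prob (0 : R) (1 : R) (B i))%E.

Definition mutually_independent (d d' : measure_display) (T : measurableType d)
    (T' : measurableType d') (R : realType) (P : probability T R)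
    (X : nat -> {RV P >-> T'}) : Prop :=
  forall (s : seq nat) (A : nat -> set T'), uniq s ->
    (forall k, measurable (A k)) ->
    P [set w | forall k, k \in s -> A k (X k w)]
      = (\prod_(k <- s) P (X k @^-1` A k))%E.

Definition implicit_scheme (d : measure_display) (T : measurableType d)
    (R : realType) (P : probability T R) n (mu gamma0 : R)
    (f : 'cV[R]_n -> R) (Sh : 'M[R]_n) (x0 v0 : 'cV[R]_n) (alpha : nat -> R)
    (eta : nat -> {RV P >-> n.-tuple R})
    (x v : nat -> T -> 'cV[R]_n) (gamma : nat -> R) : Prop :=
  [/\ gamma 0%N = gamma0,
      forall k, gamma k.+1 = (gamma k + alpha k * mu) / (1 + alpha k),
      forall w, x 0%N w = x0 /\ v 0%N w = v0
    & forall k w,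
        let tau := (alpha k)^-1 + mu / gamma k in
        let c := (1 + tau)^-1 *: (v k w + tau *: x k w) in
        let lam := alpha k / (gamma k * (1 + tau)) in
        let xi := (Num.sqrt (alpha k) / (1 + tau))
                    *: (Sh *m col_of_tuple (eta k w)) in
        is_prox lam f (c + xi) (x k.+1 w) /\
        v k.+1 w = x k.+1 w + (alpha k)^-1 *: (x k.+1 w - x k w)].

Definition mean_sq_dist (d : measure_display) (T : measurableType d)
    (R : realType) (P : probability T R) n (X : T -> 'cV[R]_n)
    (p : 'cV[R]_n) : \bar R :=
  ('E_P[(fun w => enorm (X w - p) ^+ 2)%R])%E.

(* Only meaningful for k >= 1. *)
Definition lyapunov (d : measure_display) (T : measurableType d)
    (R : realType) (P : probability T R) n (theta : R)
    (x : nat -> T -> 'cV[R]_n) (p : 'cV[R]_n) (k : nat) : \bar R :=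
  (mean_sq_dist P (x k) p + theta%:E * mean_sq_dist P (x k.-1) p)%E.

(* Main.v *)
Require Import Defs.
From HB Require Import structures.
From mathcomp Require Import all_boot all_order all_algebra.
From mathcomp Require Import all_classical all_reals all_analysis.
From mathcomp Require Import measurable_realfun ring lra.
Set Implicit Arguments.
Unset Strict Implicit.
Unset Printing Implicit Defensive.
Import Order.TTheory GRing.Theory Num.Theory.
Import numFieldNormedType.Exports.
Local Open Scope classical_set_scope.
Local Open Scope ring_scope.

(** The proximal map of a mu-strongly convex function contracts distances by
    1 / (1 + lam mu) ([prox_contract]) and fixes the minimizer xs. The damping
    parameters gamma_k stay bounded because they are averages of gamma_0 and mu, so
    lam_k mu is at least a fixed multiple kappa alpha_k of the step size, and the proximal
    map of step k divides squared distances to xs by at least (kappa alpha_k)^2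
    ([contraction_rate_le_prox], [implicit_step]).

    The point c_k to which the proximal map is applied is an extrapolation of x_k
    along x_k - x_(k-1) with coefficient at most 1 / alpha_(k-1)
    ([extrapolation_le]). Hence the squared error of x_(k+1) is bounded by
    a multiple of 1 / lo times the squared error of x_k, plus a multiple of 1 / lo^2
    times the one of x_(k-1), plus a multiple of 1 / alpha_k times the squared noise
    ([two_step_bound]). Choosing theta = 1 / lo turns this two-term recursion, after
    taking expectations, into the one-term recursion for the Lyapunov function, with
    G = 12 / kappa^2 + 1. The noise is separated from the rest by
    |a + b|^2 <= 2 |a|^2 + 2 |b|^2, which gives a bound valid for every outcome
    before expectations are taken.

    Two probabilistic facts remain. The iterates have to be measurable
    for expectations to be additive; they are Lipschitz functions of measurable
    vectors, and [measurable_lipschitz_comp] shows that this is enough. And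
    E |Sh eta|^2 must be bounded by a dimension-free multiple of the trace
    ([expectation_sqr_sqrt_mul]), which follows from the symmetry of the normal law,
    the finiteness of its second moment, and Fubini for pairs of coordinates.

    Iterating the affine recursion gives the summed bound. The asymptotic bound also
    needs the first value of the Lyapunov function to be finite
    ([first_iterate_fin_num]), after which the recursion is driven to its fixed
    point ([affine_recursion_limsup]). *)

(** * Euclidean geometry and the proximal map *)

Section Euclid.
Variables (R : realType) (n : nat).
Implicit Types (u v w : 'cV[R]_n) (a : R).

Lemma dotpC u v : dotp u v = dotp v u.
Proof. by apply: eq_bigr => i _; rewrite mulrC. Qed.

Lemma dotpDl u v w : dotp (u + v) w = dotp u w + dotp v w.
Proof. by rewrite -big_split; apply: eq_bigr => i _; rewrite mxE mulrDl. Qed.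

Lemma dotpZl a u v : dotp (a *: u) v = a * dotp u v.
Proof. by rewrite big_distrr; apply: eq_bigr => i _; rewrite mxE -mulrA. Qed.

Lemma dotpNl u v : dotp (- u) v = - dotp u v.
Proof. by rewrite -scaleN1r dotpZl mulN1r. Qed.

Lemma dotpDr u v w : dotp w (u + v) = dotp w u + dotp w v.
Proof. by rewrite ![dotp w _]dotpC dotpDl. Qed.

Lemma dotpZr a u v : dotp v (a *: u) = a * dotp v u.
Proof. by rewrite ![dotp v _]dotpC dotpZl. Qed.

Lemma dotpNr u v : dotp v (- u) = - dotp v u.
Proof. by rewrite ![dotp v _]dotpC dotpNl. Qed.

Definition dotpE := (dotpDl, dotpDr, dotpNl, dotpNr, dotpZl, dotpZr).

Lemma dotp_ge0 u : 0 <= dotp u u.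
Proof. by apply: sumr_ge0 => i _; rewrite -expr2 sqr_ge0. Qed.

Lemma dotp_eq0 u : dotp u u = 0 -> u = 0.
Proof.
move=> /eqP; rewrite psumr_eq0 => [/allP u0|i _]; last by rewrite -expr2 sqr_ge0.
apply/matrixP => i j; rewrite ord1 mxE.
by have := u0 i (mem_index_enum i); rewrite mulf_eq0 orbb => /eqP.
Qed.

Lemma sqr_enorm u : enorm u ^+ 2 = dotp u u.
Proof. by rewrite sqr_sqrtr ?dotp_ge0. Qed.

Lemma sqr_entry_le_dotp u i : u i 0 ^+ 2 <= dotp u u.
Proof.
rewrite /dotp (bigD1 i)//= -expr2 lerDl.
by apply: sumr_ge0 => j _; rewrite -expr2 sqr_ge0.
Qed.

(** The parallelogram law separates the noise v from the rest of the prox argument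
    pointwise; the factor 2 only enlarges the constants of the recursion. *)
Lemma dotp_sub_addr u v w :
  dotp (u + v - w) (u + v - w) <= 2 * dotp (u - w) (u - w) + 2 * dotp v v.
Proof.
by have := dotp_ge0 (u - w - v); rewrite !dotpE ![dotp _ v]dotpC ![dotp w u]dotpC; lra.
Qed.

(** From (1 + b) u - b v = u + b (u - v), the squared norm is at most
    (1 + 2 b) ((1 + b) |u|^2 + b |v|^2), and b <= 1. The factor b is kept in
    front of |v|^2 because it pairs with the weight theta of the previous
    iterate in the Lyapunov function. *)
Lemma dotp_extrapolation u v b : 0 <= b <= 1 ->
  dotp (u + b *: (u - v)) (u + b *: (u - v))
    <= 6 * dotp u u + 3 * b * dotp v v.
Proof.
move=> /andP[b0 b1].
have uv := dotp_ge0 (u + v); have u0 := dotp_ge0 u; have v0 := dotp_ge0 v.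
move: uv; rewrite !dotpE ![dotp v u]dotpC.
move: (dotp u u) (dotp v v) (dotp u v) u0 v0 => U V D U0 V0 uv.
have h1 : 0 <= b * (1 + b) * (U + V + 2 * D).
  by rewrite !mulr_ge0 //; lra.
have h2 : 0 <= b * V * (1 - b) by rewrite !mulr_ge0 //; lra.
have h3 : 0 <= U * (1 - b) by rewrite mulr_ge0 //; lra.
have h4 : 0 <= U * (1 - b) * b by rewrite !mulr_ge0 //; lra.
nra.
Qed.

End Euclid.

Section Prox.
Variables (R : realType) (n : nat) (mu L : R) (f : 'cV[R]_n -> R).
Hypotheses (mu_gt0 : 0 < mu) (muL : mu <= L).
Hypothesis fmuL : strongly_convex_smooth mu L f.

(** First-order condition of the proximal problem. With
    g = lam grad f(p) + p - z, the upper quadratic bound on f shows that moving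
    from p by - g / (lam L + 1) would lower the objective by a positive multiple of
    |g|^2, so minimality of p forces g = 0. *)
Lemma prox_optimality lam z p : 0 < lam -> is_prox lam f z p ->
  lam *: grad f p = z - p.
Proof.
move=> lam0 zp; apply/eqP; rewrite -subr_eq0; apply/eqP.
set g : 'cV[R]_n := _ - _; apply: dotp_eq0.
have K0 : 0 < lam * L + 1 by rewrite ltr_wpDl// mulr_ge0// ltW// (lt_le_trans mu_gt0).
have := zp (p - (lam * L + 1)^-1 *: g).
have /andP[_] := fmuL (p - (lam * L + 1)^-1 *: g) p.
rewrite /is_argmin !sqr_enorm.
have -> : p - (lam * L + 1)^-1 *: g - z = (p - z) - (lam * L + 1)^-1 *: g.
  by rewrite addrAC.
rewrite [p - _ - p]addrC addKr.
have -> : p - z = g - lam *: grad f p by rewrite /g addrAC subrr add0r opprB.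
set d := f _ - f p - _ => dle.
have -> : f (p - (lam * L + 1)^-1 *: g) = d + f p + dotp (grad f p) (- ((lam * L + 1)^-1 *: g)).
  by rewrite /d addrAC !subrK.
clearbody g; move: d dle => d; rewrite !dotpE [dotp g (grad f p)]dotpC.
set t := (lam * L + 1)^-1; have t0 : 0 < t by rewrite invr_gt0.
have tK : t * (lam * L + 1) = 1 by rewrite /t mulVf ?gt_eqF.
have := dotp_ge0 g.
move: (dotp g g) (dotp (grad f p) g) (dotp (grad f p) (grad f p)) => G H D G0 dle main.
have ld : lam * d <= lam * (L / 2 * (t * (t * G))).
  by rewrite ler_pM2l//; move: dle; rewrite !mulrN opprK.
apply/eqP; rewrite eq_le G0 andbT.
have : t * G * (t * (lam * L + 1)) = t * G by rewrite tK mulr1.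
move=> e; rewrite -(pmulr_rle0 _ t0); lra.
Qed.

(** By the optimality condition z - z' = lam D + (p - p') with D the difference of
    the gradients at p and p'. Strong convexity gives <D, p - p'> >= mu |p - p'|^2
    and hence |D| >= mu |p - p'|, and expanding |z - z'|^2 gives the contraction
    factor 1 / (1 + lam mu). *)
Lemma prox_contract lam z z' p p' : 0 < lam ->
    is_prox lam f z p -> is_prox lam f z' p' ->
  (1 + lam * mu) ^+ 2 * dotp (p - p') (p - p') <= dotp (z - z') (z - z').
Proof.
move=> lam0 zp zp'.
have -> : z - z' = lam *: (grad f p - grad f p') + (p - p').
  rewrite scalerBr (prox_optimality lam0 zp) (prox_optimality lam0 zp').
  by apply/matrixP => i j; rewrite !mxE; ring.
have /andP[h _] := fmuL p p'; have /andP[h' _] := fmuL p' p.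
move: h h'; rewrite !sqr_enorm -[p' - p]opprB.
move: (p - p') => d; set D : 'cV[R]_n := grad f p - _.
have -> : dotp (grad f p) (- d) = - dotp (grad f p') d - dotp D d.
  by rewrite dotpNr /D dotpDl dotpNl opprB addKr.
clearbody D; have := dotp_ge0 (D - mu *: d); rewrite !dotpE [dotp d D]dotpC.
move: (dotp d d) (dotp D D) (dotp D d) (dotp (grad f p') d) => dd DD Dd g hD h h'.
have hd : mu * dd <= Dd by move: h h'; rewrite ?mulrN ?opprK; lra.
have hD' := mulr_ge0 (mulr_ge0 (ltW lam0) (ltW lam0)) hD.
have lm : 0 < lam + lam * lam * mu by rewrite addr_gt0 ?mulr_gt0.
have := mulr_ge0 (ltW lm) (_ : 0 <= Dd - mu * dd).
rewrite subr_ge0 => /(_ hd); lra.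
Qed.

End Prox.

(** * One deterministic step of the scheme *)

Section Step.
Variables (R : realType) (n : nat) (mu L G : R) (f : 'cV[R]_n -> R).
Hypotheses (mu_gt0 : 0 < mu) (muL : mu <= L).
Hypothesis fmuL : strongly_convex_smooth mu L f.

(** With G an upper bound on the damping parameters gamma_k, the
    proximal map of step k divides distances by at least
    contraction_rate * alpha_k; this is the source of the decay in 1 / alpha. *)
Definition contraction_rate : R := mu / (2 * G + mu).

Lemma contraction_rate_gt0 : 0 <= G -> 0 < contraction_rate.
Proof. by move=> G0; rewrite divr_gt0// ltr_wpDl// mulr_ge0. Qed.

(** The argument of the proximal map has lam = a / (g + g / a + mu), and
    g + g / a + mu <= 2 G + mu as soon as a >= 1. *)
Lemma contraction_rate_le_prox (a g : R) : 0 < g <= G -> 1 <= a ->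
  contraction_rate * a <= 1 + a / (g * (1 + (a^-1 + mu / g))) * mu.
Proof.
move=> /andP[g0 gG] a1; have a0 : 0 < a by lra.
have D0 : 0 < g + g / a + mu by rewrite !addr_gt0// divr_gt0.
have -> : g * (1 + (a^-1 + mu / g)) = g + g / a + mu.
  by field; rewrite !gt_eqF.
have G0 : 0 < 2 * G + mu by have := mu_gt0; lra.
rewrite /contraction_rate -[leLHS]add0r lerD// mulrAC [mu * a]mulrC [leRHS]mulrAC.
rewrite ler_pM2l ?mulr_gt0// lef_pV2 ?posrE//.
have : g / a <= g by rewrite ler_pdivrMr// ler_peMr// ltW.
lra.
Qed.

(** The minimizer of f is a fixed point of every proximal map, which turns the
    contraction into a bound on the distance to the minimizer. *)
Lemma is_prox_argmin lam xs : 0 < lam -> is_argmin f xs -> is_prox lam f xs xs.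
Proof.
move=> lam0 fxs x; rewrite subrr !sqr_enorm.
have -> : dotp 0 (0 : 'cV[R]_n) = 0 by rewrite -(scale0r 0) dotpZl mul0r.
rewrite mulr0 addr0 -[leLHS]addr0 lerD ?ler_pM2l//.
by rewrite mulr_ge0// ?invr_ge0 ?dotp_ge0.
Qed.

(** The noise enters the proximal argument with variance factor a / (1 + tau)^2,
    which is at most a. *)
Lemma implicit_step (a g : R) (c s p xs : 'cV[R]_n) : 0 < g <= G -> 1 <= a -> is_argmin f xs ->
    let tau := a^-1 + mu / g in
    is_prox (a / (g * (1 + tau))) f (c + (Num.sqrt a / (1 + tau)) *: s) p ->
  (contraction_rate * a) ^+ 2 * dotp (p - xs) (p - xs)
    <= 2 * dotp (c - xs) (c - xs) + 2 * (a * dotp s s).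
Proof.
move=> gG a1 fxs tau cp; have a0 : 0 < a by lra.
have /andP[g0 gG'] := gG.
have tau0 : 0 < tau by rewrite addr_gt0 ?invr_gt0// divr_gt0.
have lam0 : 0 < a / (g * (1 + tau)) by rewrite divr_gt0// mulr_gt0// addr_gt0.
have k0 := contraction_rate_gt0 (le_trans (ltW g0) gG').
have := prox_contract mu_gt0 muL fmuL lam0 cp (is_prox_argmin lam0 fxs).
have kl := contraction_rate_le_prox gG a1.
move=> h; apply: (le_trans (y := dotp (c + (Num.sqrt a / (1 + tau)) *: s - xs)
                                      (c + (Num.sqrt a / (1 + tau)) *: s - xs))).
  apply: le_trans h; rewrite ler_wpM2r ?dotp_ge0// lerXn2r// ?nnegrE.
    by rewrite mulr_ge0// ltW.
  by rewrite addr_ge0// mulr_ge0// ltW.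
apply: (le_trans (dotp_sub_addr _ _ _)); rewrite lerD2l ler_pM2l//.
rewrite !dotpE mulrA ler_wpM2r ?dotp_ge0//.
rewrite -expr2 exprMn sqr_sqrtr ?(ltW a0)// ler_piMr ?(ltW a0)//.
have t1 : 0 < 1 + tau by lra.
by apply: exprn_ile1; rewrite ?invr_ge0 ?invf_le1; lra.
Qed.

(** For a point v produced by the previous step, v - x is a multiple of the
    increment x - y, so the centre c is x extrapolated along x - y with the
    coefficient b = 1 / ((1 + tau) a') <= 1 / a' <= 1. *)
Lemma extrapolation_le (a a' g : R) (x y xs : 'cV[R]_n) : 0 < g -> 1 <= a -> 1 <= a' ->
    let tau := a^-1 + mu / g in
    let c := (1 + tau)^-1 *: ((x + a'^-1 *: (x - y)) + tau *: x) in
  dotp (c - xs) (c - xs)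
    <= 6 * dotp (x - xs) (x - xs) + 3 / a' * dotp (y - xs) (y - xs).
Proof.
move=> g0 a1 a1' /=; set tau := a^-1 + mu / g; set c := _ *: _.
have a0 : 0 < a by lra. have a0' : 0 < a' by lra.
have tau0 : 0 < tau by rewrite addr_gt0 ?invr_gt0// divr_gt0.
have t1 : 0 < 1 + tau by lra.
have V1 : (1 + tau)^-1 <= 1 by rewrite invf_le1; lra.
have ba : (1 + tau)^-1 / a' <= a'^-1 by rewrite ler_piMl ?invr_ge0 ?(ltW a0').
have -> : c - xs = (x - xs) + ((1 + tau)^-1 / a') *: ((x - xs) - (y - xs)).
  apply/matrixP => i j; rewrite !mxE; field.
  by rewrite !gt_eqF.
apply: le_trans (dotp_extrapolation _ _ _) _.
  rewrite mulr_ge0 ?invr_ge0 ?(ltW a0') ?(ltW t1)//=.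
  by rewrite (le_trans ba)// invf_le1.
by rewrite lerD2l ler_wpM2r ?dotp_ge0// ler_pM2l.
Qed.

End Step.

(** gamma_(k+1) is a convex combination of gamma_k and mu. *)
Lemma damping_bounded (R : realType) (mu gamma0 : R) (alpha gamma : nat -> R) :
  0 < mu -> 0 < gamma0 -> (forall k, 1 <= alpha k) -> gamma 0%N = gamma0 ->
  (forall k, gamma k.+1 = (gamma k + alpha k * mu) / (1 + alpha k)) ->
  forall k, 0 < gamma k <= gamma0 + mu.
Proof.
move=> mu0 g0 a1 gE gS; elim => [|k /andP[IH1 IH2]]; first by rewrite gE g0 lerDl ltW.
have ak := a1 k; have a0 : 0 < alpha k by lra.
have D0 : 0 < 1 + alpha k by lra.
rewrite gS divr_gt0//=; last by rewrite addr_gt0// mulr_gt0.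
rewrite ler_pdivrMr// mulrDr mulr1 lerD// mulrC ler_wpM2r// ?(ltW a0)//.
by rewrite lerDr ltW.
Qed.

(** * Measurability of Lipschitz images *)

Section Measurability.
Context d (T : measurableType d) (R : realType).

(** The expectations in the theorem are integrals of functions of the iterates,
    and integrals are only subadditive on measurable functions. The iterates are
    given pointwise as minimizers, so their measurability has to come from the
    nonexpansiveness of the proximal map. The hypothesis only compares values at
    points reached by Z, where proximal points are given; a sublevel set of X is
    the union of those preimages under Z of rational boxes that it contains. *)
Lemma measurable_lipschitz_comp n (Z : T -> 'cV[R]_n) (X : T -> R) :
  (forall i, measurable_fun setT (fun w => Z w i 0)) ->
  (forall w w', (X w - X w') ^+ 2 <= dotp (Z w - Z w') (Z w - Z w')) ->
  measurable_fun setT X.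
Proof.
move=> mZ XZ.
pose box (q : 'cV[rat]_n * 'cV[rat]_n) : set T :=
  \bigcap_(i in [set: 'I_n])
     (fun w => Z w i 0) @^-1` `]ratr (q.1 i 0), ratr (q.2 i 0)[%classic.
have mbox q : measurable (box q).
  apply: fin_bigcap_measurable => // i _.
  by rewrite -[X in measurable X]setTI; apply: mZ.
apply: (measurability _ (RGenInftyO.measurableE R)) => _ [_ [a ->] <-].
rewrite setTI.
have -> : X @^-1` `]-oo, a[%classic =
    \bigcup_q (if `[< box q `<=` X @^-1` `]-oo, a[%classic >] then box q else set0).
  apply/seteqP; split => w; last by move=> [q _]; case: asboolP => // /(_ w).
  rewrite /= in_itv/= => Xwa.
  (* A box of half-width e has points at distance at most sqrt n * e, which is
     smaller than a - X w. *)
  have e0 : 0 < (a - X w) / n.+1%:R by rewrite divr_gt0// subr_gt0.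
  set e := _ / _ in e0.
  have /fin_all_exists[l lP] (i : 'I_n) : exists q : rat, Z w i 0 - e < ratr q < Z w i 0.
    have /rat_in_itvoo[q] : Z w i 0 - e < Z w i 0 by rewrite ltrBlDr ltrDl.
    by rewrite in_itv => qP; exists q.
  have /fin_all_exists[u uP] (i : 'I_n) : exists q : rat, Z w i 0 < ratr q < Z w i 0 + e.
    have /rat_in_itvoo[q] : Z w i 0 < Z w i 0 + e by rewrite ltrDl.
    by rewrite in_itv => qP; exists q.
  exists (\col_i l i, \col_i u i) => //; rewrite asboolT.
    move=> i _ /=; rewrite !mxE in_itv/=.
    by have /andP[_ ->] := lP i; have /andP[-> _] := uP i.
  move=> w' boxw' /=; rewrite in_itv/= -(ltrD2r (- X w)).
  have aX : 0 < a - X w by rewrite subr_gt0.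
  apply: le_lt_trans (ler_norm _) _.
  rewrite -(ltr_pXn2r (n := 2))// ?nnegrE ?(ltW aX)// real_normK ?num_real//.
  apply: le_lt_trans (XZ _ _) _.
  apply: (le_lt_trans (y := n%:R * e ^+ 2)).
    rewrite mulr_natl -[X in _ *+ X](card_ord n) -sumr_const.
    apply: ler_sum => i _; rewrite -expr2 !mxE -real_normK ?num_real//.
    rewrite lerXn2r ?nnegrE ?(ltW e0)// ler_norml.
    have := boxw' i Logic.I; rewrite /= in_itv/= !mxE => /andP[l1 u1].
    have /andP[l2 _] := lP i; have /andP[_ u2] := uP i.
    by apply/andP; split; lra.
  rewrite /e expr_div_n mulrA ltr_pdivrMr ?exprn_gt0//.
  rewrite mulrC ltr_pM2l ?exprn_gt0// -natrX ltr_nat.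
  by rewrite expnS expn1 mulSn ltn_addr.
by apply: countable_bigcupT_measurable => // q; case: ifP.
Qed.

End Measurability.

(** * Moments of the standard normal law *)

Section NormalMoments.
Variable R : realType.
Local Notation lambda := (@lebesgue_measure R).
Local Notation N := (normal_prob (0 : R) (1 : R)).
Local Open Scope ereal_scope.

(** The normal law is defined by its density, so by uniqueness the density is
    almost everywhere its Radon-Nikodym derivative. *)
Lemma ge0_integral_normal (f : R -> \bar R) :
  measurable_fun [set: R] f -> (forall x, 0 <= f x) ->
  \int[N]_x f x = \int[lambda]_x (f x * (normal_pdf 0 1 x)%:E).
Proof.
move=> mf f0.
have dom := @normal_prob_dominates R 0 1.
rewrite -(Radon_Nikodym_SigmaFinite.change_of_variables dom)//.
apply: ae_eq_integral => //.
- apply: emeasurable_funM => //.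
  apply: (measurable_int lambda).
  exact: Radon_Nikodym_SigmaFinite.f_integrable.
- apply: emeasurable_funM => //.
  by apply/measurable_EFinP; exact: measurable_normal_pdf.
- apply: ae_eqe_mul2l; apply: integral_ae_eq => //.
  + exact: Radon_Nikodym_SigmaFinite.f_integrable.
  + by apply/measurable_EFinP; exact: measurable_normal_pdf.
  + by move=> A _ mA; rewrite -Radon_Nikodym_SigmaFinite.f_integral.
Qed.

(** With u = x^2 / 4, this is u exp (- 2 u) <= exp (- u), a consequence of
    1 + u <= exp u; a normal density of larger variance thus dominates. *)
Lemma sqr_normal_pdf_le (x : R) :
  (x ^+ 2 * normal_pdf 0 1 x <=
   4 * normal_peak 1 / normal_peak (Num.sqrt 2) * normal_pdf 0 (Num.sqrt 2) x)%R.
Proof.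
have s2 : (Num.sqrt 2 != 0 :> R)%R by rewrite gt_eqF// sqrtr_gt0.
have p2 := normal_peak_gt0 s2.
have p1 : (0 < normal_peak 1 :> R)%R by apply: normal_peak_gt0; rewrite oner_eq0.
rewrite !normal_pdfE ?oner_eq0// /normal_fun subr0 sqr_sqrtr// expr1n.
rewrite mulrA divfK ?gt_eqF// mulrCA -mulrA [leRHS]mulrCA ler_pM2l//.
rewrite !mulNr !mulr2n.
have -> : (x ^+ 2 / (1 + 1) = x ^+ 2 / (2 + 2) + x ^+ 2 / (2 + 2))%R by field.
rewrite opprD expRD mulrA ler_wpM2r ?expR_ge0//.
rewrite expRN ler_pdivrMr ?expR_gt0//.
have xE : (x ^+ 2 = 4 * (x ^+ 2 / (2 + 2)))%R by field.
by have := expR_ge1Dx (x ^+ 2 / (2 + 2)); lra.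
Qed.

(** Finiteness is all that the noise term asks for: the value of the second moment
    is absorbed in its constant. *)
Lemma normal_second_moment_lty : \int[N]_x (x ^+ 2)%:E < +oo.
Proof.
rewrite ge0_integral_normal; last 2 first.
- by apply/measurable_EFinP; exact: measurable_funX.
- by move=> x; rewrite lee_fin sqr_ge0.
have s2 : (Num.sqrt 2 != 0 :> R)%R by rewrite gt_eqF// sqrtr_gt0.
set K : R := (4 * normal_peak 1 / normal_peak (Num.sqrt 2))%R.
apply: (@le_lt_trans _ _ (\int[lambda]_x (K%:E * (normal_pdf 0 (Num.sqrt 2) x)%:E))).
  apply: ge0_le_integral => //.
  - by move=> x _; rewrite -EFinM lee_fin mulr_ge0 ?sqr_ge0 ?normal_pdf_ge0.
  - apply: emeasurable_funM; apply/measurable_EFinP; first exact: measurable_funX.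
    exact: measurable_normal_pdf.
  - apply: emeasurable_funM => //; apply/measurable_EFinP.
    exact: measurable_normal_pdf.
  - by move=> x _; rewrite -!EFinM lee_fin sqr_normal_pdf_le.
rewrite integralZl//; last exact: integrable_normal_pdf.
by rewrite integral_normal_pdf mule1 ltry.
Qed.

Definition normal_second_moment : R := fine (\int[N]_x (x ^+ 2)%:E).

Lemma normal_second_momentE : \int[N]_x (x ^+ 2)%:E = normal_second_moment%:E.
Proof.
rewrite fineK// ge0_fin_numE ?normal_second_moment_lty//.
by apply: integral_ge0 => x _; rewrite lee_fin sqr_ge0.
Qed.

Lemma normal_second_moment_ge0 : (0 <= normal_second_moment)%R.
Proof. by apply/fine_ge0/integral_ge0 => x _; rewrite lee_fin sqr_ge0. Qed.

(** The density is even and Lebesgue measure is invariant under reflection. *)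
Lemma normal_probN (A : set R) : measurable A ->
  pushforward N (-%R : _ -> measurableTypeR R) A = N A.
Proof.
move=> mA; rewrite /pushforward /normal_prob.
have -> : \int[lambda]_(x in A) (normal_pdf 0 1 x)%:E =
   \int[pushforward lambda (-%R : _ -> measurableTypeR R)]_(x in A) (normal_pdf 0 1 x)%:E.
  by apply: eq_measure_integral => //= B mB _; rewrite lebesgue_measureN.
rewrite ge0_integral_pushforward//.
- apply: eq_integral => x _; congr EFin.
  by rewrite /= !normal_pdfE ?oner_eq0// /normal_fun !subr0 sqrrN.
- by apply/measurable_EFinP/measurable_funTS; exact: measurable_normal_pdf.
- by move=> x _; rewrite lee_fin normal_pdf_ge0.
Qed.

Lemma integrable_normal_id : N.-integrable [set: R] (fun x => x%:E).
Proof.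
apply: (@le_integrable _ _ _ N setT measurableT _ (fun x => (1 + x ^+ 2)%:E)).
- exact/measurable_EFinP.
- move=> x _ /=; rewrite lee_fin.
  rewrite [leRHS]ger0_norm ?addr_ge0 ?sqr_ge0// -(real_normK (num_real x)).
  have := sqr_ge0 (`|x| - 1)%R; have := normr_ge0 x; nra.
- apply/integrableP; split.
    by apply/measurable_EFinP/measurable_funD => //; exact: measurable_funX.
  under eq_integral do rewrite gee0_abs ?lee_fin ?addr_ge0 ?sqr_ge0//.
  under eq_integral do rewrite EFinD.
  rewrite ge0_integralD//; last 2 first.
    by move=> x _; rewrite lee_fin sqr_ge0.
    by apply/measurable_EFinP/measurable_funX.
  rewrite normal_second_momentE integral_cst// mul1e.
  rewrite [X in X + _](_ : _ = 1); last exact: integral_normal_pdf.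
  by rewrite ltry.
Qed.

(** The mean equals its opposite because the law is symmetric. *)
Lemma normal_mean : \int[N]_x x%:E = 0.
Proof.
have e : \int[N]_x x%:E = \int[N]_x (- x)%:E.
  transitivity (\int[pushforward N (-%R : _ -> measurableTypeR R)]_x x%:E).
    by apply: eq_measure_integral => //= B mB _; rewrite normal_probN.
  rewrite integral_pushforward//.
  by rewrite preimage_setT; exact: (integrableN integrable_normal_id).
have fin := integrable_fin_num measurableT integrable_normal_id.
move: e; under [X in _ = X -> _]eq_integral do rewrite EFinN.
rewrite integralN; last by rewrite integrable_add_def//; exact: integrable_normal_id.
rewrite -(fineK fin) -EFinN => -[] e; congr EFin; lra.
Qed.

End NormalMoments.

(** * Second moments of Gaussian vectors *)

Section GaussianVector.
Context d (T : measurableType d) (R : realType) (P : probability T R).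
Variables (n : nat) (eta : {RV P >-> n.-tuple R}).
Hypothesis eta_std : std_gaussian eta.
Local Notation N := (normal_prob (0 : R) (1 : R)).

(** The codomain is the real line with the Borel structure on which the normal
    law is defined, so that the law of a coordinate can be compared with it. *)
Definition coord (i : 'I_n) (w : T) : measurableTypeR R := tnth (eta w) i.

Lemma measurable_coordR i : measurable_fun setT (coord i : T -> R).
Proof. by apply: (measurableT_comp (measurable_tnth i)). Qed.

Lemma measurable_coord i : measurable_fun setT (coord i).
Proof. exact: measurable_coordR. Qed.

Local Open Scope ereal_scope.

Let N1 : N [set: R] = 1.
Proof. exact: integral_normal_pdf. Qed.

(** The product formula on boxes with all other sides equal to the full line. *)
Lemma coord_law i (A : set R) : measurable A -> P (coord i @^-1` A) = N A.
Proof.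
move=> mA; have := eta_std (B := fun j => if j == i then A else setT).
rewrite (bigD1 i)//= eqxx big1 ?mule1 => [|j /negPf ->//].
have -> : [set w | forall j, (if j == i then A else setT) (tnth (eta w) j)] = coord i @^-1` A.
  apply/seteqP; split => w /=; first by move=> /(_ i); rewrite eqxx.
  by move=> Aw j; case: eqP => // ->.
by apply => j; case: eqP.
Qed.

Lemma coord_law2 i j (A B : set R) : i != j -> measurable A -> measurable B ->
  P (coord i @^-1` A `&` coord j @^-1` B) = N A * N B.
Proof.
move=> ij mA mB; have ji : (j == i) = false by rewrite eq_sym (negPf ij).
have := eta_std (B := fun k => if k == i then A else if k == j then B else setT).
rewrite (bigD1 i)//= eqxx (bigD1 j) ?ji//= eqxx.
rewrite big1 ?mule1 => [|k /andP[/negPf -> /negPf ->]//].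
have -> : [set w | forall k, (if k == i then A else if k == j then B else setT)
     (tnth (eta w) k)] = coord i @^-1` A `&` coord j @^-1` B.
  apply/seteqP; split => w /=.
    move=> h; split; first by have := h i; rewrite eqxx.
    by have := h j; rewrite ji eqxx.
  by move=> [Aw Bw] k; case: eqP => [->//|_]; case: eqP => [->//|].
by apply => k; case: eqP => // _; case: eqP.
Qed.

Lemma coord_sqr i : \int[P]_w (coord i w ^+ 2)%:E = (normal_second_moment R)%:E.
Proof.
rewrite -normal_second_momentE.
transitivity (\int[pushforward P (coord i)]_x (x ^+ 2)%:E).
  rewrite ge0_integral_pushforward//.
  - exact: measurable_coord.
  - by apply/measurable_EFinP; exact: measurable_funX.
  - by move=> x _; rewrite lee_fin sqr_ge0.
apply: eq_measure_integral => [|mphi A mA _]; first exact: measurable_coord.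
exact: coord_law.
Qed.

Lemma integrable_coordM i j :
  P.-integrable setT (fun w => (coord i w * coord j w)%:E).
Proof.
have sq k : P.-integrable setT (fun w => (coord k w ^+ 2)%:E).
  apply/integrableP; split.
    by apply/measurable_EFinP; apply: measurable_funX; exact: measurable_coordR.
  under eq_integral do rewrite gee0_abs ?lee_fin ?sqr_ge0//.
  by rewrite coord_sqr ltry.
apply: (le_integrable measurableT _ _ (integrableD measurableT (sq i) (sq j))).
  by apply/measurable_EFinP; apply: measurable_funM; exact: measurable_coordR.
move=> w _ /=; rewrite lee_fin [leRHS]ger0_norm ?addr_ge0 ?sqr_ge0//.
rewrite normrM -(real_normK (num_real (coord i w))) -(real_normK (num_real (coord j w))).
have := sqr_ge0 (`|coord i w| - `|coord j w|)%R.
have := normr_ge0 (coord i w); have := normr_ge0 (coord j w).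
move: `|coord i w|%R `|coord j w|%R => a b a0 b0; nra.
Qed.

(** Two distinct coordinates have the product of two standard normal laws as joint
    law, so by Fubini the expectation of their product is the square of the
    mean. *)
Lemma coordM_eq0 i j : i != j -> \int[P]_w (coord i w * coord j w)%:E = 0.
Proof.
move=> ij.
pose Z (w : T) : measurableTypeR R * measurableTypeR R := (coord i w, coord j w).
have mZ : measurable_fun setT Z by apply: measurable_fun_pair; exact: measurable_coord.
pose g (z : measurableTypeR R * measurableTypeR R) : \bar R := (z.1 * z.2)%:E.
have mg : measurable_fun setT g.
  by apply/measurable_EFinP/measurable_funM; [exact: measurable_fst|exact: measurable_snd].
have lawZ A : measurable A -> (N \x N) A = pushforward P Z A.
  move=> mA; apply: product_measure_unique => // B C mB mC.
  by rewrite -(coord_law2 ij).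
have ig : (N \x N).-integrable setT g.
  apply/integrableP; split => //.
  rewrite (eq_measure_integral (pushforward P Z)) => [|A mA _]; last exact: lawZ.
  have : (pushforward P Z).-integrable setT g.
    by apply: integrable_pushforward => //; exact: integrable_coordM.
  by move=> /integrableP[].
transitivity (\int[pushforward P Z]_z g z).
  by rewrite integral_pushforward//; exact: integrable_coordM.
transitivity (\int[N \x N]_z g z).
  by apply: eq_measure_integral => // A mA _; exact/esym/lawZ.
rewrite -integral12_prod_meas1//.
rewrite [LHS](eq_integral (fun=> 0)); first by rewrite integral0.
move=> x _; rewrite /fubini_F /g/=.
under eq_integral do rewrite EFinM.
rewrite integralZl//; last exact: integrable_normal_id.
by rewrite normal_mean mule0.
Qed.

Lemma dotp_mulmx_sqrt (S Sh : 'M[R]_n) (u : 'cV[R]_n) : is_psd_sqrt S Sh ->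
  (dotp (Sh *m u) (Sh *m u) = \sum_j \sum_l S j l * (u j 0 * u l 0))%R.
Proof.
move=> [[ShT _] ShS].
transitivity (((Sh *m u)^T *m (Sh *m u)) 0 0)%R.
  by rewrite mxE; apply: eq_bigr => i _; rewrite !mxE.
rewrite trmx_mul ShT mulmxA -[(u^T *m _ *m _)%R]mulmxA ShS -mulmxA mxE.
apply: eq_bigr => j _; rewrite !mxE big_distrr; apply: eq_bigr => l _.
by rewrite mulrCA.
Qed.

(** Expanding |Sh eta|^2 = sum_(j, l) S_jl eta_j eta_l, only the diagonal terms
    have a nonzero expectation. This keeps the constant independent of the
    dimension. *)
Lemma expectation_sqr_sqrt_mul (S Sh : 'M[R]_n) : is_psd_sqrt S Sh ->
  'E_P[(fun w => enorm (Sh *m col_of_tuple (eta w)) ^+ 2)%R]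
    = (normal_second_moment R * \tr S)%:E.
Proof.
move=> hS; rewrite unlock.
under eq_integral => w _.
  rewrite sqr_enorm (dotp_mulmx_sqrt _ hS) -sumEFin.
  under eq_bigr => j _.
    rewrite -sumEFin.
    under eq_bigr => l _ do rewrite !mxE EFinM.
    over.
  over.
have int1 j l : P.-integrable setT
   (fun w => (S j l)%:E * (tnth (eta w) j * tnth (eta w) l)%:E).
  by apply: integrableZl => //; exact: integrable_coordM.
rewrite integral_sum//; last by move=> j; apply: integrable_sum.
under eq_bigr => j _ do rewrite integral_sum//.
rewrite mulr_sumr -sumEFin; apply: eq_bigr => j _.
rewrite (bigD1 j)//= big1 ?adde0 => [|l lj].
  rewrite integralZl//; last exact: integrable_coordM.
  rewrite mulrC EFinM; congr (_ * _); rewrite -(coord_sqr j).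
  by apply: eq_integral => w _; rewrite expr2.
rewrite integralZl//; last exact: integrable_coordM.
by rewrite [X in _ * X](coordM_eq0 (i := j) (j := l)) ?mule0// eq_sym.
Qed.

End GaussianVector.

(** * Random vectors *)

Section RandomVectors.
Context d (T : measurableType d) (R : realType) (P : probability T R).

Definition measurable_vector n (X : T -> 'cV[R]_n) : Prop :=
  forall i, measurable_fun setT (fun w => X w i 0).

Lemma measurable_vectorD n (X Y : T -> 'cV[R]_n) :
  measurable_vector X -> measurable_vector Y -> measurable_vector (fun w => X w + Y w).
Proof.
move=> mX mY i; under eq_fun do rewrite mxE.
exact: measurable_funD.
Qed.

Lemma measurable_vector_mulmx n p (A : 'M[R]_(p, n)) (X : T -> 'cV[R]_n) :
  measurable_vector X -> measurable_vector (fun w => A *m X w).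
Proof.
move=> mX i; under eq_fun do rewrite mxE.
by apply: measurable_sum => j; apply: measurable_funM.
Qed.

Lemma measurable_vectorZ n (a : R) (X : T -> 'cV[R]_n) :
  measurable_vector X -> measurable_vector (fun w => a *: X w).
Proof.
move=> mX i; under eq_fun do rewrite mxE.
exact: measurable_funM.
Qed.

Lemma measurable_vector_cst n (c : 'cV[R]_n) : measurable_vector (fun=> c).
Proof. by move=> i; exact: measurable_cst. Qed.

Lemma measurable_vector_coord n (eta : {RV P >-> n.-tuple R}) :
  measurable_vector (fun w => col_of_tuple (eta w)).
Proof.
move=> i; under eq_fun do rewrite mxE.
by apply: (measurableT_comp (measurable_tnth i)).
Qed.

Lemma measurable_sqr_enorm n (X : T -> 'cV[R]_n) : measurable_vector X ->
  measurable_fun setT (fun w => enorm (X w) ^+ 2).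
Proof.
move=> mX; under eq_fun do rewrite sqr_enorm.
by apply: measurable_sum => i; apply: measurable_funM.
Qed.

Lemma measurable_vector_prox n (mu L lam : R) (f : 'cV[R]_n -> R)
    (z p : T -> 'cV[R]_n) :
  0 < mu -> mu <= L -> strongly_convex_smooth mu L f -> 0 < lam ->
  (forall w, is_prox lam f (z w) (p w)) ->
  measurable_vector z -> measurable_vector p.
Proof.
move=> mu0 muL fmuL lam0 zp mz i.
apply: (measurable_lipschitz_comp mz) => w w'.
apply: le_trans (prox_contract mu0 muL fmuL lam0 (zp w) (zp w')).
have := sqr_entry_le_dotp (p w - p w') i; rewrite !mxE => /le_trans; apply.
by rewrite ler_peMl ?dotp_ge0// exprn_ege1// lerDl mulr_ge0// ltW.
Qed.

(** Stated in the extended reals, so that it can be applied along the recursion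
    before the iterates are known to be square integrable. *)
Lemma ge0_expectation_le3 (X Y Z W : T -> R) (a b c : R) :
  [/\ measurable_fun setT X, measurable_fun setT Y,
      measurable_fun setT Z & measurable_fun setT W] ->
  (forall w, [/\ 0 <= X w, 0 <= Y w, 0 <= Z w & 0 <= W w]) ->
  0 <= a -> 0 <= b -> 0 <= c ->
  (forall w, X w <= a * Y w + b * Z w + c * W w) ->
  ('E_P[X] <= a%:E * 'E_P[Y] + b%:E * 'E_P[Z] + c%:E * 'E_P[W])%E.
Proof.
move=> [mX mY mZ mW] ge0 a0 b0 c0 le; rewrite unlock.
have scale (r : R) (U : T -> R) : 0 <= r -> measurable_fun setT U ->
    (forall w, 0 <= U w) ->
    (r%:E * \int[P]_w (U w)%:E = \int[P]_w (r * U w)%:E)%E.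
  move=> r0 mU U0; rewrite -ge0_integralZl//.
  - exact/measurable_EFinP.
  - by move=> w _; rewrite lee_fin.
rewrite !scale//; try by move=> w; have [] := ge0 w.
have mM (r : R) (U : T -> R) : measurable_fun setT U ->
    measurable_fun setT (fun w => (r * U w)%:E).
  by move=> mU; apply/measurable_EFinP; exact: measurable_funM.
have M0 w : [/\ 0 <= a * Y w, 0 <= b * Z w & 0 <= c * W w].
  by have [_ Y0 Z0 W0] := ge0 w; rewrite !mulr_ge0.
rewrite -ge0_integralD//; try exact: mM; try by move=> w _; rewrite lee_fin; have [] := M0 w.
rewrite -ge0_integralD//; try exact: mM; last 3 first.
- by move=> w _; rewrite -EFinD lee_fin; have [? ? _] := M0 w; rewrite addr_ge0.
- by apply: emeasurable_funD; exact: mM.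
- by move=> w _; rewrite lee_fin; have [] := M0 w.
apply: ge0_le_integral => //.
- by move=> w _; rewrite lee_fin; have [] := ge0 w.
- exact/measurable_EFinP.
- by apply: emeasurable_funD; [apply: emeasurable_funD|]; exact: mM.
- by move=> w _; rewrite -!EFinD lee_fin.
Qed.

End RandomVectors.

(** * Affine recursions in the extended reals *)

Section Recursion.
Variable R : realType.
Local Open Scope ereal_scope.

(** The recursion can be unfolded even where V is infinite, since multiplication
    by a finite number distributes over a sum with a finite term. *)
Lemma affine_recursion_sum (V : nat -> \bar R) (rho : R) (s : nat -> R) :
  (0 <= rho)%R ->
  (forall k, (1 <= k)%N -> V k.+1 <= rho%:E * V k + (s k)%:E) ->
  forall k, (1 <= k)%N -> V k <= (rho ^+ k.-1)%:E * V 1%N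
     + (\sum_(1 <= t < k) rho ^+ (k.-1 - t) * s t)%R%:E.
Proof.
move=> rho0 Vs; case=> // k _; elim: k => [|k IH].
  by rewrite big_geq// expr0 mul1e adde0.
apply: le_trans (Vs k.+1 isT) _.
rewrite big_nat_recr//= subnn expr0 mul1r EFinD addeA leeD2r//.
apply: (le_trans (lee_wpmul2l _ IH)); first by rewrite lee_fin.
rewrite muleDr// ?fin_num_adde_defl// muleA -EFinM -exprS leeD2l//.
rewrite -EFinM lee_fin mulr_sumr /=.
rewrite [leLHS]big_nat_cond [leRHS]big_nat_cond; apply: ler_sum => t.
rewrite andbT => /andP[_ tk]; rewrite mulrA -exprS -subSn//.
Qed.

Lemma limn_esup_mono (u v : nat -> \bar R) :
  (forall k, (1 <= k)%N -> u k <= v k) -> limn_esup u <= limn_esup v.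
Proof.
move=> uv; rewrite !limn_esup_lim; apply: lee_lim; try exact: is_cvg_esups.
exists 1%N => // m /= m1; apply: ge_ereal_sup => _ [k /= mk <-].
apply: le_trans (uv k (leq_trans m1 mk)) _.
by apply: ereal_sup_ubound; exists k.
Qed.

(** The number S / (1 - rho) is the fixed point of t |-> rho t + S, and V
    exceeds it by at most a geometrically decaying amount. Finiteness of the first
    term is essential: an infinite V satisfies the same recursion. *)
Lemma affine_recursion_limsup (V : nat -> \bar R) (rho S : R) :
  (0 < rho < 1)%R -> (0 <= S)%R -> V 1%N \is a fin_num ->
  (forall k, (1 <= k)%N -> V k.+1 <= rho%:E * V k + S%:E) ->
  limn_esup V <= (S / (1 - rho))%:E.
Proof.
move=> /andP[rho0 rho1] S0 V1 Vs.
have B0 : (0 <= S / (1 - rho))%R by rewrite divr_ge0// subr_ge0 ltW.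
(* V 1 / rho makes the exponent equal to the index, including at index 1. *)
pose u k : R := (rho ^+ k * (fine (V 1%N) / rho) + S / (1 - rho))%R.
have Vu k : (1 <= k)%N -> V k <= (u k)%:E.
  case: k => // k _; elim: k => [|k IH].
    rewrite /u -{1}(fineK V1) lee_fin expr1 mulrC divfK ?gt_eqF//.
    by rewrite lerDl.
  apply: le_trans (Vs k.+1 isT) _.
  apply: (le_trans (leeD2r _ (lee_wpmul2l _ IH))); first by rewrite lee_fin ltW.
  rewrite -EFinM -EFinD lee_fin /u [in leRHS]exprS le_eqVlt.
  apply/orP; left; apply/eqP; field.
  by rewrite subr_eq0 !gt_eqF.
apply: (le_trans (limn_esup_mono Vu)).
suff : (EFin \o u) @ \oo --> (S / (1 - rho))%:E.
  by move=> /cvg_limn_einf_sup[_ ->].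
apply: cvg_EFin; first by apply: nearW.
have lim0 : (rho ^+ k * (fine (V 1%N) / rho))%R @[k --> \oo] --> (0 * (fine (V 1%N) / rho))%R.
  by apply: cvgMl; apply: cvg_expr; rewrite ger0_norm// ltW.
have := cvgD lim0 (cvg_cst (S / (1 - rho))%R).
by rewrite mul0r add0r; apply.
Qed.

End Recursion.

(** * The iterates of the scheme *)

Section Scheme.
Context d (T : measurableType d) (R : realType) (P : probability T R) (n : nat).
Variables (mu L gamma0 : R) (f : 'cV[R]_n -> R) (xs : 'cV[R]_n).
Variables (Sh : 'M[R]_n) (eta : nat -> {RV P >-> n.-tuple R}).
Variables (alpha gamma : nat -> R) (x0 v0 : 'cV[R]_n) (x v : nat -> T -> 'cV[R]_n).
Hypotheses (mu_gt0 : 0 < mu) (muL : mu <= L) (gamma0_gt0 : 0 < gamma0).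
Hypotheses (fmuL : strongly_convex_smooth mu L f) (fxs : is_argmin f xs).
Hypothesis alpha_ge1 : forall k, 1 <= alpha k.
Hypothesis scheme : implicit_scheme mu gamma0 f Sh x0 v0 alpha eta x v gamma.

Let rate : R := contraction_rate mu (gamma0 + mu).
Let noise k w : R := enorm (Sh *m col_of_tuple (eta k w)) ^+ 2.
Let err k w : R := enorm (x k w - xs) ^+ 2.

Lemma scheme_damping k : 0 < gamma k <= gamma0 + mu.
Proof. by case: scheme => g0 gS _ _; exact: damping_bounded. Qed.

Let rate_gt0 : 0 < rate.
Proof. by apply: contraction_rate_gt0 => //; rewrite addr_ge0 ?ltW. Qed.

Let alpha_gt0 k : 0 < alpha k. Proof. by have := alpha_ge1 k; lra. Qed.

Lemma measurable_iterates k : measurable_vector (x k) /\ measurable_vector (v k).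
Proof.
have [_ _ init step] := scheme; elim: k => [|k [mx mv]].
  have -> : x 0%N = fun=> x0 by apply/funext => w; have [] := init w.
  have -> : v 0%N = fun=> v0 by apply/funext => w; have [] := init w.
  by split; exact: measurable_vector_cst.
have mx' : measurable_vector (x k.+1).
  have /andP[g0 _] := scheme_damping k.
  have t0 : 0 < 1 + ((alpha k)^-1 + mu / gamma k).
    by rewrite !addr_gt0 ?invr_gt0 ?divr_gt0.
  have lam0 : 0 < alpha k / (gamma k * (1 + ((alpha k)^-1 + mu / gamma k))).
    by rewrite divr_gt0 ?mulr_gt0.
  apply: (measurable_vector_prox mu_gt0 muL fmuL lam0 (fun w => proj1 (step k w))).
  apply: measurable_vectorD; apply: measurable_vectorZ.
    by apply: measurable_vectorD => //; exact: measurable_vectorZ.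
  by apply: measurable_vector_mulmx; exact: measurable_vector_coord.
split=> //.
have -> : v k.+1 = fun w => x k.+1 w + (alpha k)^-1 *: (x k.+1 w + (-1) *: x k w).
  by apply/funext => w; rewrite scaleN1r; have [] := step k w.
apply: measurable_vectorD => //; apply: measurable_vectorZ.
by apply: measurable_vectorD => //; exact: measurable_vectorZ.
Qed.

Let measurable_err k : measurable_fun setT (err k).
Proof.
apply: measurable_sqr_enorm; apply: measurable_vectorD; last exact: measurable_vector_cst.
by have [] := measurable_iterates k.
Qed.

Let measurable_noise k : measurable_fun setT (noise k).
Proof.
apply: measurable_sqr_enorm; apply: measurable_vector_mulmx.
exact: measurable_vector_coord.
Qed.

Lemma one_step_bound k w :
  let tau := (alpha k)^-1 + mu / gamma k in
  let c := (1 + tau)^-1 *: (v k w + tau *: x k w) in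
  (rate * alpha k) ^+ 2 * err k.+1 w
     <= 2 * dotp (c - xs) (c - xs) + 2 * (alpha k * noise k w).
Proof.
have [_ _ _ step] := scheme; have [h _] := step k w.
rewrite /err /noise !sqr_enorm /=.
exact: (implicit_step mu_gt0 muL fmuL (scheme_damping k) (alpha_ge1 k) fxs h).
Qed.

(** Dividing the one-step bound by (rate alpha)^2 leaves 1 / alpha^2 in front of
    the errors. One factor 1 / alpha <= 1 is dropped and the other is bounded by
    1 / lo; the extrapolation coefficient 1 / alpha_k supplies a second factor
    1 / lo for the older error. The noise keeps exactly one factor 1 / alpha. *)
Lemma two_step_bound lo k w : 0 < lo -> lo <= alpha k -> lo <= alpha k.+1 ->
  err k.+2 w <= 12 / rate ^+ 2 / lo * err k.+1 w
     + 6 / rate ^+ 2 / lo / lo * err k w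
     + 2 / rate ^+ 2 / alpha k.+1 * noise k.+1 w.
Proof.
move=> lo0 loa loa'.
have := one_step_bound k.+1 w; rewrite /=.
have [_ _ _ step] := scheme; have [_ ->] := step k w.
have /andP[g0 _] := scheme_damping k.+1.
have := extrapolation_le mu_gt0 (x k.+1 w) (x k w) xs g0 (alpha_ge1 k.+1) (alpha_ge1 k).
rewrite /= -!sqr_enorm -!/(err _ _).
set c := enorm _ ^+ 2 => hc h.
have a1 := alpha_ge1 k.+1.
have e0 j : 0 <= err j w by rewrite sqr_ge0.
have D0 : 0 < (rate * alpha k.+1) ^+ 2 by rewrite exprn_gt0// mulr_gt0.
rewrite -(ler_pM2l D0); apply: (le_trans h).
have r20 : 0 < rate ^+ 2 by rewrite exprn_gt0.
have -> : (rate * alpha k.+1) ^+ 2 * (12 / rate ^+ 2 / lo * err k.+1 w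
     + 6 / rate ^+ 2 / lo / lo * err k w + 2 / rate ^+ 2 / alpha k.+1 * noise k.+1 w) =
   12 * (alpha k.+1 * (alpha k.+1 / lo)) * err k.+1 w
   + 6 * (alpha k.+1 * (alpha k.+1 / lo)) / lo * err k w + 2 * (alpha k.+1 * noise k.+1 w).
  by field; rewrite !gt_eqF.
rewrite lerD2r.
have q1 : 1 <= alpha k.+1 * (alpha k.+1 / lo).
  have : 1 <= alpha k.+1 / lo by rewrite ler_pdivlMr// mul1r.
  by move=> alo; rewrite -[leLHS]mulr1; apply: ler_pM.
have q2 : (alpha k)^-1 <= lo^-1 by rewrite lef_pV2 ?posrE.
apply: (le_trans (ler_wpM2l _ hc)) => //.
set q := alpha k.+1 * _ in q1 *.
have q3 : lo^-1 <= q * lo^-1 by rewrite ler_peMl// invr_ge0 ltW.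
rewrite mulrDr; apply: lerD; rewrite mulrA; apply: ler_wpM2r => //; first by lra.
by rewrite -[6 * q / lo]mulrA; lra.
Qed.

Local Open Scope ereal_scope.

(** Here x_0 and v_0 are deterministic, so that the one-step bound has a constant
    deterministic part. *)
Lemma first_iterate_fin_num : 'E_P[noise 0] < +oo -> 'E_P[err 1] \is a fin_num.
Proof.
move=> noise_lty; rewrite ge0_fin_numE; last by apply: expectation_ge0 => w; exact: sqr_ge0.
pose tau := ((alpha 0%N)^-1 + mu / gamma 0%N)%R.
pose c : 'cV[R]_n := ((1 + tau)^-1 *: (v0 + tau *: x0))%R.
pose q := ((rate * alpha 0%N) ^+ 2)%R.
have q0 : (0 < q)%R by rewrite exprn_gt0// mulr_gt0.
have le w : (err 1 w <= 2 / q * dotp (c - xs) (c - xs) + 0 * 0 + 2 * alpha 0%N / q * noise 0 w)%R.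
  have := one_step_bound 0 w; have [_ _ init _] := scheme.
  have [-> ->] := init w; rewrite -/tau -/c -/q => h.
  rewrite -(ler_pM2l q0); apply: (le_trans h).
  rewrite le_eqVlt; apply/orP; left; apply/eqP; field.
  by rewrite gt_eqF.
have p0 : (0 <= 2 * alpha 0%N / q)%R.
  by apply: divr_ge0; [apply: mulr_ge0 => //; exact: ltW|exact: ltW].
apply: (le_lt_trans (ge0_expectation_le3 P _ _ _ _ _ le)).
- by split => //; exact: measurable_cst.
- by move=> w; split; rewrite ?sqr_ge0 ?dotp_ge0.
- by rewrite divr_ge0 ?ltW.
- by [].
- exact: p0.
rewrite !expectation_cst mul0e adde0 -EFinM.
rewrite lte_add_pinfty ?ltry// lte_mul_pinfty// lee_fin.
Qed.

Lemma mean_two_step lo k : (0 < lo)%R -> (lo <= alpha k)%R -> (lo <= alpha k.+1)%R ->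
  'E_P[err k.+2] <= (12 / rate ^+ 2 / lo)%:E * 'E_P[err k.+1]
     + (6 / rate ^+ 2 / lo / lo)%:E * 'E_P[err k]
     + (2 / rate ^+ 2 / alpha k.+1)%:E * 'E_P[noise k.+1].
Proof.
move=> lo0 loa loa'; apply: ge0_expectation_le3.
- by split.
- by move=> w; split; rewrite sqr_ge0.
- by rewrite !divr_ge0 ?sqr_ge0 ?ltW.
- by rewrite !divr_ge0 ?sqr_ge0 ?ltW.
- by rewrite !divr_ge0 ?sqr_ge0 ?ltW.
- by move=> w; exact: two_step_bound.
Qed.

End Scheme.

(** * The Lyapunov recursion *)

Lemma psd_sqrt_trace_ge0 (R : realType) n (S Sh : 'M[R]_n) :
  is_psd_sqrt S Sh -> 0 <= \tr S.
Proof.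
move=> [[ShT _] <-]; apply: sumr_ge0 => i _; rewrite mxE; apply: sumr_ge0 => j _.
by rewrite -{2}ShT mxE -expr2 sqr_ge0.
Qed.

(** Both readings of sigma2 give the same bound. The factor 1 + m, with m the
    second moment of the standard normal law, serves for both: at least m for the
    trace, and at least 1 for a direct bound. *)
Lemma noise_second_moment_le d (T : measurableType d) (R : realType)
    (P : probability T R) n (S Sh : 'M[R]_n) (sigma2 : R)
    (eta : nat -> {RV P >-> n.-tuple R}) :
  is_psd_sqrt S Sh -> (forall k, std_gaussian (eta k)) ->
  (sigma2 = \tr S \/ forall k,
    ('E_P[(fun w => enorm (Sh *m col_of_tuple (eta k w)) ^+ 2)%R] <= sigma2%:E)%E) ->
  0 <= sigma2 /\ forall k,
    ('E_P[(fun w => enorm (Sh *m col_of_tuple (eta k w)) ^+ 2)%R]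
       <= ((1 + normal_second_moment R) * sigma2)%:E)%E.
Proof.
move=> hS std; have m0 := normal_second_moment_ge0 R; case=> [->|le].
  have tr0 := psd_sqrt_trace_ge0 hS; split=> // k.
  by rewrite (expectation_sqr_sqrt_mul (std k) hS) lee_fin ler_wpM2r// lerDr.
have s0 : 0 <= sigma2.
  rewrite -lee_fin; apply: le_trans (le 0%N).
  by apply: expectation_ge0 => w; rewrite sqr_ge0.
split=> // k; apply: (le_trans (le k)).
by rewrite lee_fin ler_peMl// lerDl.
Qed.

Theorem theorem3p2 (R : realType) (mu L gamma0 : R)
    (hmu : 0 < mu) (hmuL : mu <= L) (hgamma0 : 0 < gamma0) :
  (* theta = Theta(1 / lo), with c1, c2 uniform in lo and hi *)
  exists c1 c2 : R, [/\ 0 < c1, 0 < c2 &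
  forall lo hi : R, 0 < lo -> lo <= hi ->
  exists G C theta : R,
  [/\ 0 < G, 0 < C, c1 / lo <= theta, theta <= c2 / lo &
  forall (n : nat) (f : 'cV[R]_n -> R) (xstar : 'cV[R]_n)
    (d : measure_display) (T : measurableType d) (P : probability T R)
    (Sigma Sigma_half : 'M[R]_n) (sigma2 : R)
    (eta : nat -> {RV P >-> n.-tuple R})
    (alpha : nat -> R) (x0 v0 : 'cV[R]_n)
    (x v : nat -> T -> 'cV[R]_n) (gamma : nat -> R),
    (forall y, differentiable f y) ->
    strongly_convex_smooth mu L f ->
    is_argmin f xstar ->
    psd Sigma -> is_psd_sqrt Sigma Sigma_half ->
    (forall k, std_gaussian (eta k)) -> mutually_independent eta ->
    (sigma2 = \tr Sigma \/
      forall k,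
        ('E_P[(fun w => enorm (Sigma_half *m col_of_tuple (eta k w)) ^+ 2)%R]
           <= sigma2%:E)%E) ->
    (forall k, 1 <= alpha k) -> (forall k, lo <= alpha k <= hi) ->
    implicit_scheme mu gamma0 f Sigma_half x0 v0 alpha eta x v gamma ->
    let V := lyapunov P theta x xstar in
    let rho := G / lo in
    [/\ forall k, (1 <= k)%N ->
          (V k.+1 <= (G / lo)%:E * V k + (C * sigma2 / alpha k)%:E)%E,
        forall k, (1 <= k)%N ->
          (V k <= (rho ^+ k.-1)%:E * V 1%N
                  + (\sum_(1 <= t < k)
                       rho ^+ (k.-1 - t) * (C * sigma2 / alpha t))%:E)%E
      & G < lo ->
          (limn_esup (fun k => mean_sq_dist P (x k) xstar) <= limn_esup V)%E /\
          (limn_esup V <= (C * sigma2 / (lo * (1 - G / lo)))%:E)%E]]].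
Proof.
pose rate := contraction_rate mu (gamma0 + mu).
have rate0 : 0 < rate by apply: contraction_rate_gt0 => //; rewrite addr_ge0 ?ltW.
pose m2 := normal_second_moment R; have m20 : 0 <= m2 := normal_second_moment_ge0 R.
pose G := 12 / rate ^+ 2 + 1; pose C := 2 / rate ^+ 2 * (1 + m2).
have r20 : 0 < rate ^+ 2 by rewrite exprn_gt0.
have G0 : 0 < G by rewrite addr_gt0// divr_gt0.
have C0 : 0 < C by rewrite mulr_gt0 ?divr_gt0//; lra.
exists 1, 1; split=> // lo hi lo0 lohi.
exists G, C, lo^-1; split; rewrite ?div1r//.
move=> n f xs d T P S Sh sigma2 eta alpha x0 v0 x v gamma fdiff fmuL fxs Spsd ShS std indep
  hsigma alpha1 alphalo scheme V rho.
have [s20 noise_le] := noise_second_moment_le ShS std hsigma.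
have lo_le k : lo <= alpha k by have /andP[] := alphalo k.
have a0 k : 0 < alpha k by rewrite (lt_le_trans lo0).
have m_ge0 k : (0 <= mean_sq_dist P (x k) xs)%E.
  by apply: expectation_ge0 => w; rewrite sqr_ge0.
have rho0 : 0 < rho by rewrite divr_gt0.
have rec k : (1 <= k)%N ->
    (V k.+1 <= rho%:E * V k + (C * sigma2 / alpha k)%:E)%E.
  case: k => // k _.
  have := mean_two_step hmu hmuL hgamma0 fmuL fxs alpha1 scheme lo0 (lo_le k) (lo_le k.+1).
  rewrite -/rate -!/(mean_sq_dist P (x _) xs) => le2.
  rewrite /V /lyapunov /=.
  apply: (le_trans (leeD2r _ le2)).
  have := noise_le k.+1.
  move: (m_ge0 k.+1) (m_ge0 k).
  set m1 := mean_sq_dist _ (x k.+1) _; set m0 := mean_sq_dist _ (x k) _ => m1_ge0 m0_ge0 nle.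
  rewrite addeAC; apply: leeD; last first.
    apply: (le_trans (lee_wpmul2l _ nle)); first by rewrite lee_fin !divr_ge0 ?ltW.
    rewrite -EFinM lee_fin /C /m2 le_eqVlt; apply/orP; left; apply/eqP; field.
    by rewrite !gt_eqF.
  have li0 : 0 <= lo^-1 by rewrite invr_ge0 ltW.
  have b0 : 0 <= 12 / rate ^+ 2 / lo by rewrite !divr_ge0 ?ltW.
  (* The weight theta = 1 / lo is exactly what the recursion produces: the
     coefficients 12 / rate^2 / lo + theta of the newer error and
     (6 / rate^2 / lo) theta of the older one are both covered by G / lo. *)
  rewrite ge0_muleDr// ?mule_ge0// ?lee_fin ?invr_ge0 ?(ltW lo0)// addeAC.
  rewrite -ge0_muleDl ?lee_fin// muleA -!EFinD -EFinM.
  apply: leeD; apply: lee_wpmul2r => //; rewrite lee_fin /rho /G.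
    rewrite le_eqVlt; apply/orP; left; apply/eqP; field.
    by rewrite !gt_eqF.
  rewrite ler_wpM2r ?invr_ge0 ?(ltW lo0)// ler_wpM2r ?invr_ge0 ?(ltW lo0)//.
  have : 0 < rate ^- 2 by rewrite invr_gt0.
  lra.
split.
- exact: rec.
- exact: (affine_recursion_sum (ltW rho0) rec).
- move=> Glo; split.
    apply: limn_esup_mono => k _.
    by rewrite leeDl// mule_ge0// lee_fin invr_ge0 ltW.
  have rho1 : rho < 1 by rewrite ltr_pdivrMr// mul1r.
  have -> : C * sigma2 / (lo * (1 - G / lo)) = C * sigma2 / lo / (1 - rho).
    by rewrite invfM mulrA.
  apply: affine_recursion_limsup.
  - by rewrite rho0 rho1.
  - by apply: divr_ge0; [apply: mulr_ge0 => //; exact: ltW|exact: ltW].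
  - have fin1 : mean_sq_dist P (x 1%N) xs \is a fin_num.
      apply: (first_iterate_fin_num hmu hmuL hgamma0 fmuL fxs alpha1 scheme).
      by rewrite (le_lt_trans (noise_le 0%N))// ltry.
    have -> : V 1%N = (mean_sq_dist P (x 1%N) xs + (lo^-1 * enorm (x0 - xs) ^+ 2)%:E)%E.
      rewrite /V /lyapunov /=; congr (_ + _)%E; rewrite EFinM; congr (_ * _)%E.
      rewrite -(expectation_cst P); congr ('E_P[_]%E); apply/funext => w.
      by have [_ _ init _] := scheme; have [-> _] := init w.
    by rewrite fin_numD fin1.
  - move=> k k1; apply: (le_trans (rec k k1)); rewrite leeD2l// lee_fin.
    apply: ler_wpM2l; first by apply: mulr_ge0 => //; exact: ltW.
    by rewrite lef_pV2 ?posrE.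
Qed.
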